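(* Let $n\ge 1$ and let $(X(i),F(i))$, $i=0,1,\dots,n$, be a martingale with $F(0)$ trivial and $\mathbf{E}X(i)=0$ for all $i$ (so that $X(0)=0$ almost everywhere). Let $\xi(j)=X(j)-X(j-1)$, $j=1,\dots,n$, be the martingale differences, and suppose that for each $j=1,\dots,n$ the conditional subgaussian norm $\theta(j)=\|\xi(j)\|_{\mathrm{Sub}(F(j-1))}$ is finite. Put $\Delta(n)=\sqrt{\sum_{j=1}^n\theta^2(j)}$. Then $$\|X(n)\|_{\mathrm{Sub}}\le\Delta(n),$$ and, if $\Delta(n)>0$, for all $x\ge 0$, $$\max\left(\mathbf{P}\left(\frac{X(n)}{\Delta(n)}>x\right),\ \mathbf{P}\left(\frac{X(n)}{\Delta(n)}<-x\right)\right)\le e^{-x^2/2}.$$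
   Context: A real random variable $\xi$ with $\mathbf{E}\xi=0$ is called subgaussian if there is $\tau\ge 0$ such that $\mathbf{E}e^{\lambda\xi}\le e^{\lambda^2\tau^2/2}$ for all $\lambda\in\mathbb{R}$; the smallest such $\tau$ is its subgaussian norm $\|\xi\|_{\mathrm{Sub}}$. For a sub-sigma-algebra $F$, the conditional subgaussian norm $\|\eta\|_{\mathrm{Sub}(F)}$ of a random variable $\eta$ is the smallest non-random constant $\tau\ge 0$ such that for all $\lambda\in\mathbb{R}$, $\mathbf{E}[e^{\lambda\eta}\mid F]\le e^{\lambda^2\tau^2/2}$ almost everywhere (it is infinite if no such $\tau$ exists). *)

(* Defs.v *)
From HB Require Import structures.
From mathcomp Require Import all_boot all_order all_algebra.
From mathcomp Require Import all_classical all_reals all_analysis.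
From mathcomp Require Import measurable_realfun.
Set Implicit Arguments.
Unset Strict Implicit.
Unset Printing Implicit Defensive.
Import Order.TTheory GRing.Theory Num.Theory.
Import numFieldNormedType.Exports.
Local Open Scope classical_set_scope.
Local Open Scope ring_scope.

Section defs.
Context (d : measure_display) (T : measurableType d) (R : realType).
Variable P : probability T R.
Implicit Types (G : set (set T)) (F : nat -> set (set T)).

Definition sub_sigma_algebra_of G : Prop :=
  sigma_algebra [set: T] G /\ G `<=` measurable.

Definition measurable_wrt (d' : measure_display) (U : measurableType d') G
    (f : T -> U) : Prop :=
  measurable_fun [set: g_sigma_algebraType G] (f : g_sigma_algebraType G -> U).

(* [h] is a version of E[f | G].  The two disjuncts are the two classical
   settings in which conditional expectations exist: f nonnegative (and then h
   takes values in [0, +oo]), or f integrable. *)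
Definition is_cond_expectation G (f h : T -> \bar R) : Prop :=
  [/\ measurable_wrt G h,
      (measurable_fun [set: T] f /\ forall t, (0 <= f t)%E /\ (0 <= h t)%E) \/
      (P.-integrable [set: T] f /\ P.-integrable [set: T] h) &
      forall A, G A -> (\int[P]_(t in A) h t = \int[P]_(t in A) f t)%E].

(* (X(i), F(i)), 0 <= i <= n; the values at indices above n are irrelevant. *)
Definition is_martingale (n : nat) F (X : nat -> T -> R) : Prop :=
  [/\ forall i, (i <= n)%N -> sub_sigma_algebra_of (F i),
      forall i, (i < n)%N -> F i `<=` F i.+1,
      forall i, (i <= n)%N -> measurable_wrt (F i) (X i),
      forall i, (i <= n)%N -> P.-integrable [set: T] (EFin \o X i) &
      forall i, (i < n)%N ->
        is_cond_expectation (F i) (EFin \o X i.+1) (EFin \o X i)].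

(* Triviality up to P: this includes the sigma-algebra {set0, setT}. *)
Definition trivial_sigma_algebra G : Prop :=
  forall A, G A -> P A = 0%E \/ P A = 1%E.

Definition subgaussian_const (xi : T -> R) (tau : R) : Prop :=
  0 <= tau /\
  forall lambda : R,
    ('M_P xi lambda <= (expR (lambda ^+ 2 * tau ^+ 2 / 2))%:E)%E.

(* By continuity in tau this infimum is a minimum whenever it is finite; it is
   +oo if there is no admissible tau.  The same holds for [cond_sub_norm]. *)
Definition sub_norm (xi : T -> R) : \bar R :=
  ereal_inf [set tau%:E | tau in subgaussian_const xi].

(* Versions of a conditional expectation exist and agree almost everywhere, so
   it does not matter which version is bounded. *)
Definition cond_subgaussian_const G (eta : T -> R) (tau : R) : Prop :=
  0 <= tau /\
  forall lambda : R, exists h : T -> \bar R,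
    is_cond_expectation G (EFin \o (expR \o lambda \o* eta)) h /\
    {ae P, forall t, (h t <= (expR (lambda ^+ 2 * tau ^+ 2 / 2))%:E)%E}.

Definition cond_sub_norm G (eta : T -> R) : \bar R :=
  ereal_inf [set tau%:E | tau in cond_subgaussian_const G eta].

(* The following three are meant for indices j >= 1. *)
Definition mart_diff (X : nat -> T -> R) (j : nat) : T -> R :=
  X j \- X j.-1.

Definition theta F (X : nat -> T -> R) (j : nat) : \bar R :=
  cond_sub_norm (F j.-1) (mart_diff X j).

Definition Delta F (X : nat -> T -> R) (n : nat) : R :=
  Num.sqrt (\sum_(1 <= j < n.+1) fine (theta F X j) ^+ 2).

End defs.

(* Main.v *)
(**
  With [c j = exp (l^2 theta(j)^2 / 2)], conditioning on [F (j - 1)] gives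
    [E exp (l X(j)) = E (exp (l X(j - 1)) E[exp (l xi(j)) | F(j - 1)])
                   <= c j * E exp (l X(j - 1))],
  and these inequalities telescope down to [E exp (l X(0)) = 1], because a
  centred variable measurable with respect to a trivial sigma-algebra vanishes
  almost everywhere.  The tail bound is then Chernoff's inequality with parameter
  [x / Delta(n)].

  The conditional expectation is only used through the inequalities
  [E (1_A exp (l xi(j))) <= c j * P A] for [A] in [F (j - 1)]: they pass to the
  infimum defining [theta(j)] without discussing versions, and they extend from
  indicators to nonnegative [F (j - 1)]-measurable weights by monotone
  convergence.
*)
Require Import Defs.
From mathcomp Require Import all_boot all_order all_algebra.
From mathcomp Require Import all_classical all_reals all_analysis.
From mathcomp Require Import measurable_realfun.
From mathcomp Require Import ring.
Import Order.TTheory GRing.Theory Num.Theory.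
Import numFieldNormedType.Exports.
Local Open Scope classical_set_scope.
Local Open Scope ring_scope.
Import HBNNSimple.

(** * Measurability with respect to a sub-sigma-algebra *)

Lemma sub_sigma_algebra_measurable {d : measure_display}
    {T : measurableType d} {G : set (set T)} :
  sub_sigma_algebra_of G -> (<<s G >>) `<=` measurable.
Proof. by move=> [sG GT]; rewrite sigma_algebra_id. Qed.

Lemma measurable_wrt_measurable {d d' : measure_display}
    {T : measurableType d} {U : measurableType d'} {G : set (set T)}
    {f : T -> U} :
  sub_sigma_algebra_of G -> measurable_wrt G f -> measurable_fun [set: T] f.
Proof.
move=> sG mf _ Y mY; apply: (sub_sigma_algebra_measurable sG).
exact: (mf measurableT Y mY).
Qed.

Lemma measurable_wrt_preimage {d d' : measure_display}
    {T : measurableType d} {U : measurableType d'} {G : set (set T)}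
    {f : T -> U} {Y : set U} :
  sub_sigma_algebra_of G -> measurable_wrt G f -> measurable Y ->
  G (f @^-1` Y).
Proof.
move=> [sG _] mf mY; rewrite -[G](sigma_algebra_id sG) -[_ @^-1` _]setTI.
exact: (mf measurableT Y mY).
Qed.

(** * Integrals against nonnegative weights *)

Section integral_mul.
Context {d : measure_display} {T : measurableType d} {R : realType}.
Variable mu : {measure set T -> \bar R}.
Local Open Scope ereal_scope.

(** Write [s] as the finite sum of [y] times the indicator of its level set at [y], and integrate
    term by term. Only integrals of [g] over level sets of [s] remain. *)
Lemma ge0_integral_fimfunM (s : {fimfun T >-> R}) (g : T -> \bar R) :
  (forall y, measurable (s @^-1` [set y])) -> (forall t, (0 <= s t)%R) ->
  measurable_fun setT g -> (forall t, 0 <= g t) ->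
  \int[mu]_t ((s t)%:E * g t) =
  \sum_(y \in range s) (y%:E * \int[mu]_(t in s @^-1` [set y]) g t).
Proof.
move=> ms s0 mg g0.
have mi y : measurable_fun setT (fun t => (\1_(s @^-1` [set y]) t)%:E * g t).
  by apply: emeasurable_funM => //; apply/measurable_EFinP.
have i0 y t : 0 <= (\1_(s @^-1` [set y]) t)%:E * g t.
  by rewrite mule_ge0// lee_fin.
(* [max y 0] makes the summand nonnegative for every [y], as
   [ge0_integral_fsum] requires; it is [y] on the range of [s]. *)
transitivity (\int[mu]_t \sum_(y \in range s)
    ((Num.max y 0)%:E * ((\1_(s @^-1` [set y]) t)%:E * g t))).
  apply: eq_integral => t _.
  rewrite [in LHS]fimfunE -fsumEFin// ge0_mule_fsuml; last first.
    move=> y; rewrite lee_fin indicE; have [|_] := boolP (t \in _).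
      by rewrite inE => /= <-; rewrite mulr1.
    by rewrite mulr0.
  apply: eq_fsbigr => y; rewrite inE => -[u _ <-].
  by rewrite EFinM muleA max_l.
rewrite ge0_integral_fsum//; first last.
- by move=> y t _; rewrite mule_ge0// lee_fin le_max lexx orbT.
- by move=> y; exact: measurable_funeM.
apply: eq_fsbigr => y; rewrite inE => -[u _ <-].
rewrite ge0_integralZl//; last by rewrite lee_fin le_max lexx orbT.
rewrite max_l//; congr (_ * _).
rewrite [RHS]integral_mkcond; apply: eq_integral => t _.
by rewrite epatch_indic muleC.
Qed.

Lemma le_integral_measurable_wrtM (G : set (set T)) (f g w : T -> R) :
  sub_sigma_algebra_of G -> measurable_wrt G w -> (forall t, (0 <= w t)%R) ->
  measurable_fun setT f -> (forall t, (0 <= f t)%R) ->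
  measurable_fun setT g -> (forall t, (0 <= g t)%R) ->
  (forall A, G A -> \int[mu]_(t in A) (f t)%:E <= \int[mu]_(t in A) (g t)%:E) ->
  \int[mu]_t (w t * f t)%:E <= \int[mu]_t (w t * g t)%:E.
Proof.
move=> sG mw w0 mf f0 mg g0 fg.
have mwE : measurable_fun [set: g_sigma_algebraType G] (EFin \o w).
  exact/measurable_EFinP.
(* The approximation is built on the space carrying the sigma-algebra generated by [G], so that the
   level sets of each [s n] lie in [G], where [fg] applies. *)
pose s : {nnsfun (g_sigma_algebraType G) >-> R}^nat :=
  nnsfun_approx measurableT mwE.
have s0 n t : (0 <= s n t)%R by [].
have sw t : (s n t)%:E @[n --> \oo] --> (w t)%:E.
  by apply: (cvg_nnsfun_approx measurableT mwE) => // u _; rewrite lee_fin.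
have ms n y : G (s n @^-1` [set y]).
  by apply: (measurable_wrt_preimage sG) => //; exact: measurable_funPT.
have msT n : measurable_fun [set: T] (s n).
  by apply: (measurable_wrt_measurable sG); exact: measurable_funPT.
have s_nd t : {homo s ^~ t : m n / (m <= n)%N >-> (m <= n)%R}.
  by move=> m n mn; exact/(lefP _ _ (nd_nnsfun_approx measurableT mwE mn)).
have cvgs (h : T -> R) : measurable_fun setT h -> (forall t, (0 <= h t)%R) ->
    \int[mu]_t ((s n t)%:E * (h t)%:E) @[n --> \oo] -->
    \int[mu]_t (w t * h t)%:E.
  move=> mh h0.
  have -> : \int[mu]_t (w t * h t)%:E =
      \int[mu]_t limn (fun n => (s n t)%:E * (h t)%:E).
    apply: eq_integral => t _; apply/esym/cvg_lim => //.
    by rewrite EFinM; apply: cvgeZr.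
  apply: cvg_monotone_convergence => //.
  - by move=> n; apply: emeasurable_funM; exact/measurable_EFinP.
  - by move=> n t _; rewrite mule_ge0// lee_fin.
  - by move=> t _ m n mn; rewrite lee_wpmul2r// lee_fin ?s_nd.
have cf := cvgs f mf f0; have cg := cvgs g mg g0.
rewrite -(cvg_lim _ cf)// -(cvg_lim _ cg)//; apply: lee_lim.
- by apply/cvg_ex; eexists; exact: cf.
- by apply/cvg_ex; eexists; exact: cg.
apply: nearW => n.
have sE (h : T -> R) : measurable_fun setT h -> (forall t, (0 <= h t)%R) ->
    \int[mu]_t ((s n t)%:E * (h t)%:E) = \sum_(y \in range (s n))
      (y%:E * \int[mu]_(t in s n @^-1` [set y]) (h t)%:E).
  move=> mh h0; apply: (@ge0_integral_fimfunM (s n) (EFin \o h)) => //.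
  - by move=> y; exact: (proj2 sG _ (ms n y)).
  - exact/measurable_EFinP.
(* The two sums are compared term by term: each [y] is a value of [s n], hence a nonnegative
   factor. *)
rewrite !sE//; apply: lee_fsum => // y [t _ <-].
by rewrite lee_wpmul2l ?lee_fin ?fg.
Qed.

End integral_mul.

(** * Conditional subgaussian bounds and trivial sigma-algebras *)

Section cond_subgaussian.
Context {d : measure_display} {T : measurableType d} {R : realType}.
Variable P : probability T R.
Implicit Types (G : set (set T)).
Local Open Scope ereal_scope.

(* [h] may be negative somewhere when [f] is integrable, hence the passage
   through the positive part of [h]. *)
Lemma cond_expectation_integral_le G (f h : T -> \bar R) (c : R) (A : set T) :
  sub_sigma_algebra_of G -> is_cond_expectation P G f h -> (0 <= c)%R ->
  {ae P, forall t, h t <= c%:E} -> G A ->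
  \int[P]_(t in A) f t <= c%:E * P A.
Proof.
move=> sG [mh _ hf] c0 hc GA; have mA := proj2 sG _ GA.
have mhT : measurable_fun A h.
  by apply: measurable_funTS; exact: measurable_wrt_measurable mh.
rewrite -hf// integralE -(integral_cst P mA).
apply: (@le_trans _ _ (\int[P]_(t in A) h^\+ t)).
  by rewrite -[leRHS]sube0 leeB// integral_ge0.
apply: ae_ge0_le_integral => //; first exact: measurable_funepos.
apply: filterS hc => t ht _.
by rewrite funeposE ge_max ht/= lee_fin.
Qed.

Lemma cond_sub_norm_ge0 G (eta : T -> R) : 0 <= cond_sub_norm P G eta.
Proof.
by apply: le_ereal_inf_tmp => _ [tau [tau0 _] <-]; rewrite lee_fin.
Qed.

(** With [l] and [A] fixed, every admissible constant satisfies the bound, whose right side is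
    continuous in that constant; it therefore survives the passage to the infimum. *)
Lemma cond_sub_norm_integral_le G (eta : T -> R) (l : R) (A : set T) :
  sub_sigma_algebra_of G -> cond_sub_norm P G eta < +oo -> G A ->
  \int[P]_(t in A) (expR (eta t * l))%:E <=
  (expR (l ^+ 2 * fine (cond_sub_norm P G eta) ^+ 2 / 2))%:E * P A.
Proof.
move=> sG fin GA; have mA := proj2 sG _ GA.
set N := cond_sub_norm P G eta.
have Nfin : N \is a fin_num by rewrite ge0_fin_numE// cond_sub_norm_ge0.
pose b tau := (expR (l ^+ 2 * tau ^+ 2 / 2) * fine (P A))%R.
have le_b tau : cond_subgaussian_const P G eta tau ->
    \int[P]_(t in A) (expR (eta t * l))%:E <= (b tau)%:E.
  move=> [_ /(_ l)[h [ch hb]]].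
  rewrite /b EFinM fineK ?fin_num_measure//.
  by apply: cond_expectation_integral_le ch _ hb GA => //; exact: expR_ge0.
(* The limit is taken from the right because an admissible constant is only known to exist below
   each [tau] greater than the infimum. *)
have b_cvg : b tau @[tau --> (fine N)^'+] --> b (fine N).
  apply: cvg_at_right_filter; apply: cvgMr_tmp.
  apply: continuous_cvg; first exact: continuous_expR.
  by apply: cvgMr_tmp; apply: cvgMl_tmp; exact: exprn_continuous.
have -> : (expR (l ^+ 2 * fine N ^+ 2 / 2))%:E * P A = (b (fine N))%:E.
  by rewrite /b EFinM fineK ?fin_num_measure.
apply: (@cvge_ge _ (fine N)^'+ _ _ (EFin \o b)); last first.
  by apply: cvg_EFin; [exact: nearW|exact: b_cvg].
near=> tau.
have Ntau : (fine N < tau)%R by near: tau; exact: nbhs_right_gt.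
have [_ [tau' ctau' <-]] : exists2 x : \bar R,
    [set tau%:E | tau in cond_subgaussian_const P G eta] x &
    x < N + (tau - fine N)%:E.
  by apply: lb_ereal_inf_adherent => //; rewrite subr_gt0.
rewrite -[X in X + _](fineK Nfin) -EFinD lte_fin addrC subrK => tau'tau.
(* It remains to see that [b tau'] is at most [b tau]: [b] is nondecreasing on nonnegative reals,
   and [tau'] is nonnegative by admissibility. *)
apply: (le_trans (le_b _ ctau')).
have [tau'0 _] := ctau'.
rewrite lee_fin ler_wpM2r ?fine_ge0// ler_expR ler_wpM2r ?invr_ge0//.
by rewrite ler_wpM2l ?sqr_ge0// ler_sqr ?nnegrE// ltW// (le_lt_trans tau'0).
Unshelve. all: by end_near. Qed.

(** A set of [G] or its complement is null, so [Y] integrates to zero over every set of [G]. Taking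
    the set where [Y] is nonnegative and its complement gives [E|Y| = 0]. *)
Lemma trivial_sigma_algebra_ae0 G (Y : T -> R) :
  sub_sigma_algebra_of G -> trivial_sigma_algebra P G -> measurable_wrt G Y ->
  P.-integrable setT (EFin \o Y) -> 'E_P[Y] = 0 ->
  {ae P, forall t, Y t = 0%R}.
Proof.
move=> sG trivG mY iY; rewrite unlock => EY.
have mYT : measurable_fun setT (EFin \o Y) := measurable_int P iY.
have intY0 A : G A -> \int[P]_(t in A) (Y t)%:E = 0.
  move=> GA; have mA := proj2 sG _ GA.
  have [PA|PA] := trivG _ GA.
    by apply: null_set_integral => //; exact: measurable_funTS.
  have := EY; rewrite -(setUv A) integral_setU//.
  - rewrite [X in _ + X]null_set_integral ?adde0//.
    + exact: measurableC.
    + exact: measurable_funTS.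
    + by rewrite [LHS]probability_setC// PA subee.
  - exact: measurableC.
  - by rewrite setUv.
  - exact/disj_setPCl.
pose A := Y @^-1` `[0%R, +oo[.
have GA : G A by exact: measurable_wrt_preimage mY _.
have mA := proj2 sG _ GA.
have GAC : G (~` A).
  rewrite /A preimage_setC; apply: measurable_wrt_preimage mY _ => //.
  exact: measurableC.
have : \int[P]_t `|(Y t)%:E| = 0.
  rewrite -(setUv A) integral_setU//; first last.
  - exact/disj_setPCl.
  - by rewrite setUv; exact: measurableT_comp.
  - exact: measurableC.
  rewrite (eq_integral (fun t => (Y t)%:E)) ?(intY0 _ GA) ?add0e; last first.
    move=> t; rewrite inE /A/= in_itv/= andbT => Yt.
    by rewrite ger0_norm.
  rewrite (eq_integral (fun t => - (Y t)%:E)); last first.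
    move=> t; rewrite inE /A/= in_itv/= andbT => /negP; rewrite -ltNge => Yt.
    by rewrite ltr0_norm.
  rewrite integralN ?(intY0 _ GAC) ?oppe0//.
  apply: integrable_add_def; first exact: measurableC.
  by move: iY; apply: integrableS => //; exact: measurableC.
move/(ae_eq_integral_abs P measurableT mYT); apply: filterS => t.
by move=> /(_ I)[].
Qed.

End cond_subgaussian.

(** * Moment generating functions along the martingale *)

Section martingale.
Context {d : measure_display} {T : measurableType d} {R : realType}.
Context {P : probability T R} {n : nat} {F : nat -> set (set T)}.
Context {X : nat -> T -> R}.
Hypothesis martX : is_martingale P n F X.
Local Open Scope ereal_scope.

Lemma martingale_measurable i : (i <= n)%N -> measurable_fun setT (X i).
Proof.
have [sF _ mX _ _] := martX => ni.
by apply: (measurable_wrt_measurable (sF _ ni)); exact: mX.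
Qed.

Lemma martingale_mgf_step (l : R) (j : nat) : (j < n)%N ->
  theta P F X j.+1 < +oo ->
  'M_P (X j.+1) l <=
  (expR (l ^+ 2 * fine (theta P F X j.+1) ^+ 2 / 2))%:E * 'M_P (X j) l.
Proof.
move=> jn fin; have [sF _ mX _ _] := martX; have jn' := ltnW jn.
set c := expR _.
pose f t := expR (mart_diff X j.+1 t * l).
have mexp i : (i <= n)%N -> measurable_wrt (F i) (fun t => expR (X i t * l)).
  move=> ni; apply: measurableT_comp; first exact: measurable_expR.
  by apply: measurable_funM => //; exact: mX.
have mf : measurable_fun setT f.
  apply: measurableT_comp; first exact: measurable_expR.
  by apply: measurable_funM => //; apply: measurable_funB;
    exact: martingale_measurable.
rewrite /mmt_gen_fun !unlock.
have -> : \int[P]_t ((expR \o l \o* X j.+1) t)%:E =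
    \int[P]_t (expR (X j t * l) * f t)%:E.
  apply: eq_integral => t _; rewrite /f -expRD /mart_diff/= -mulrDl.
  by rewrite addrC subrK.
rewrite -ge0_integralZl//; first last.
- by rewrite lee_fin expR_ge0.
- by move=> t _; rewrite lee_fin expR_ge0.
- apply/measurable_EFinP.
  exact: (measurable_wrt_measurable (sF _ jn') (mexp _ jn')).
have -> : \int[P]_t (c%:E * ((expR \o l \o* X j) t)%:E) =
    \int[P]_t (expR (X j t * l) * c)%:E.
  by apply: eq_integral => t _; rewrite -EFinM mulrC.
(* The weight is [expR (X j t * l)], and the increment factor [f] is compared with the constant [c]
   on the sets of [F j]. All integrands are nonnegative, so the value [+oo] is harmless here. *)
apply: (@le_integral_measurable_wrtM _ _ _ P (F j)) => //.
- exact: sF.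
- exact: mexp.
- by move=> t; rewrite /f expR_ge0.
- by move=> _; rewrite /c expR_ge0.
- move=> A FA; have mA := proj2 (sF _ jn') _ FA.
  rewrite [leRHS](integral_cst P mA c%:E).
  exact: (@cond_sub_norm_integral_le _ _ _ P _ (mart_diff X j.+1) l A
    (sF _ jn') fin FA).
Qed.

Hypothesis F0_trivial : trivial_sigma_algebra P (F 0%N).
Hypothesis EX0 : 'E_P[X 0%N] = 0.
Hypothesis theta_fin : forall j, (1 <= j <= n)%N -> theta P F X j < +oo.

(** Induction on [k]: for [k = 0] the sum is empty and [X 0] vanishes almost everywhere, so both
    sides are 1; each further step contributes one exponential factor. *)
Lemma martingale_mgf_le (l : R) (k : nat) : (k <= n)%N ->
  'M_P (X k) l <= (expR (l ^+ 2 *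
    (\sum_(1 <= j < k.+1) fine (theta P F X j) ^+ 2) / 2))%:E.
Proof.
have [sF _ mX iX _] := martX.
elim: k => [_|k IH kn].
  have X00 : {ae P, forall t, X 0%N t = 0%R}.
    by apply: (@trivial_sigma_algebra_ae0 _ _ _ P (F 0%N)) => //;
      [exact: sF|exact: mX|exact: iX].
  rewrite big_geq// mulr0 mul0r expR0 /mmt_gen_fun unlock.
  rewrite (ae_eq_integral (cst 1))//.
  - by rewrite integral_cst//= probability_setT mule1.
  - apply/measurable_EFinP; apply: measurableT_comp => //.
    by apply: measurable_funM => //; exact: martingale_measurable.
  - by apply: filterS X00 => t /= -> _; rewrite mul0r expR0.
have theta_k : theta P F X k.+1 < +oo by exact: theta_fin.
apply: (le_trans (martingale_mgf_step l _ kn theta_k)).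
rewrite big_nat_recr//= mulrDr mulrDl addrC expRD EFinM.
by rewrite lee_wpmul2l ?lee_fin ?expR_ge0// IH// ltnW.
Qed.

Lemma martingale_subgaussian : subgaussian_const P (X n) (Delta P F X n).
Proof.
split=> [|l]; first exact: sqrtr_ge0.
rewrite sqr_sqrtr ?martingale_mgf_le//.
by apply: sumr_ge0 => j _; exact: sqr_ge0.
Qed.

End martingale.

(** * Tails of subgaussian variables *)

Section subgaussian_tail.
Context {d : measure_display} {T : measurableType d} {R : realType}.
Variable P : probability T R.
Local Open Scope ereal_scope.

(** The bound is even in [l]. This reduces the lower tail to the upper one. *)
Lemma subgaussian_constN (xi : T -> R) (tau : R) :
  subgaussian_const P xi tau -> subgaussian_const P (\- xi)%R tau.
Proof.
move=> [tau0 xitau]; split=> // l.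
have -> : 'M_P (\- xi)%R l = 'M_P xi (- l)%R.
  by congr ('E_P[_]); apply/funext => t /=; rewrite mulrN mulNr.
by rewrite -(sqrrN l).
Qed.

(** The parameter [r = x / tau] minimises the Chernoff exponent [r^2 tau^2 / 2 - r x tau], with
    minimum [- x^2 / 2]. *)
Lemma subgaussian_tail (xi : T -> R) (tau x : R) :
  measurable_fun setT xi -> (0 < tau)%R -> (0 <= x)%R ->
  subgaussian_const P xi tau ->
  P [set t | (xi t / tau > x)%R] <= (expR (- x ^+ 2 / 2))%:E.
Proof.
move=> mxi tau0 x0 [_ xitau].
pose xi' : {RV P >-> R} := mfun_Sub (mem_set mxi).
have mA : measurable [set t | (xi t / tau > x)%R].
  have -> : [set t | (xi t / tau > x)%R] =
      setT `&` (fun t => xi t / tau)%R @^-1` `]x, +oo[.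
    by apply/seteqP; split=> t /=; rewrite in_itv/= andbT => // -[].
  by apply: measurable_funM.
(* Chernoff's inequality is applied with a positive parameter, which excludes [x = 0]; there the
   claimed bound is 1. *)
have [x_eq0|x_neq0] := eqVneq x 0%R.
  by rewrite [in leRHS]x_eq0 expr0n/= oppr0 mul0r expR0; exact: probability_le1.
have x_gt0 : (0 < x)%R by rewrite lt_neqAle eq_sym x_neq0.
have r0 : (0 < x / tau)%R by rewrite divr_gt0.
apply: (@le_trans _ _ (P [set t | (x * tau <= xi' t)%R])).
  apply: le_measure; rewrite ?inE//.
    have -> : [set t | (x * tau <= xi' t)%R] =
        setT `&` xi @^-1` `[(x * tau)%R, +oo[.
      by apply/seteqP; split=> t /=; rewrite in_itv/= andbT => // -[].
    exact: (mxi measurableT).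
  by move=> t /=; rewrite ltr_pdivlMr// => /ltW.
apply: (le_trans (chernoff xi' (x * tau) r0)).
apply: (@le_trans _ _ ((expR ((x / tau) ^+ 2 * tau ^+ 2 / 2))%:E *
    (expR (- (x / tau * (x * tau))))%:E)).
  by rewrite lee_wpmul2r ?lee_fin ?expR_ge0//; exact: xitau.
rewrite -EFinM -expRD lee_fin ler_expR le_eqVlt; apply/orP; left; apply/eqP.
by field; rewrite gt_eqF.
Qed.

End subgaussian_tail.

Theorem theorem4p1 (d : measure_display) (T : measurableType d) (R : realType)
    (P : probability T R) (n : nat) (F : nat -> set (set T))
    (X : nat -> T -> R) (n_ge1 : (1 <= n)%N)
    (martX : is_martingale P n F X)
    (F0_trivial : trivial_sigma_algebra P (F 0%N))
    (EX0 : forall i : nat, (i <= n)%N -> ('E_P[X i] = 0)%E)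
    (theta_fin : forall j : nat, (1 <= j <= n)%N -> (theta P F X j < +oo)%E) :
  (sub_norm P (X n) <= (Delta P F X n)%:E)%E /\
  (0 < Delta P F X n ->
   forall x : R, 0 <= x ->
     (maxe (P [set t | (X n t / Delta P F X n > x)%R])
           (P [set t | (X n t / Delta P F X n < - x)%R])
        <= (expR (- x ^+ 2 / 2))%:E)%E).
Proof.
have subX : subgaussian_const P (X n) (Delta P F X n).
  by apply: martingale_subgaussian => //; exact: EX0.
split=> [|Delta0 x x0]; first by apply: ereal_inf_lbound; exists (Delta P F X n).
have mXn := martingale_measurable martX n (leqnn n).
rewrite ge_max subgaussian_tail//=.
have -> : [set t | (X n t / Delta P F X n < - x)%R] =
    [set t | ((\- X n)%R t / Delta P F X n > x)%R].
  by apply/seteqP; split=> t /=; rewrite mulNr ltrNr.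
apply: subgaussian_tail => //; first exact: measurable_funN.
exact: subgaussian_constN.
Qed.
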